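(* Let $r\ge 0$ and $d\ge 4r+3$ be integers. Let seven $r$-planes $X$, $X_i$ ($1\le i\le 3$), $X_{ij}=X_{ji}$ ($1\le i\ne j\le 3$) in $\mathbb{P}^d$ be given such that $$\dim\operatorname{span}(X,X_i,X_j,X_{ij})=3r+2\qquad\text{for each pair of indices } 1\le i\neq j\le 3,$$ but with no other degeneracies (i.e. the data are generic subject to these conditions, in the sense made precise in the context). Then there exists a unique $r$-plane $X_{123}\in\mathbb{G}^d_r$ such that $$\dim\operatorname{span}(X_i,X_{ij},X_{ik},X_{123})=3r+2\qquad\text{for all } \{i,j,k\}=\{1,2,3\}.$$
   Context: $\mathbb{P}^d$ is the real projective space of dimension $d$, and $\mathbb{G}^d_r$ is the Grassmannian of $r$-planes (projective subspaces of projective dimension $r$) in $\mathbb{P}^d$; equivalently, $(r+1)$-dimensional vector subspaces of $\mathbb{R}^{d+1}$. All dimensions are projective dimensions, and $\operatorname{span}$ denotes the smallest projective subspace containing the given ones. Three generic $r$-planes in $\mathbb{P}^d$ ($d\ge 3r+2$) span a $(3r+2)$-plane. Meaning of ''no other degeneracies'': let $\mathcal{P}$ be the set of septuples $(X,X_1,X_2,X_3,X_{12},X_{13},X_{23})$ of $r$-planes in $\mathbb{P}^d$ such that $\dim\operatorname{span}(X,X_1,X_2,X_3)=4r+3$ and $X_{ij}\subset\operatorname{span}(X,X_i,X_j)$ for all $1\le i<j\le 3$. (Thus $\mathcal{P}$ is a bundle, with Grassmannian fibres, over a Zariski-open subset of $(\mathbb{G}^d_r)^4$.) The assertion is that there is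 a Zariski-open dense subset of $\mathcal{P}$ such that the conclusion holds for every septuple in this subset. *)

(* Defs.v *)
From HB Require Import structures.
From mathcomp Require Import all_boot all_order all_algebra.
From mathcomp Require Import classical_sets reals.
From mathcomp Require Import mpoly.

Set Implicit Arguments.
Unset Strict Implicit.
Unset Printing Implicit Defensive.

Import Order.TTheory GRing.Theory Num.Theory.
Local Open Scope ring_scope.
Local Open Scope classical_set_scope.

(* Projective subspaces of P^d are vector subspaces of R^(d+1); the span of
   projective subspaces is the sum of the vector subspaces.  The integer-valued
   [pdim] gives the empty subspace dimension -1. *)
Definition pdim (R : realType) (d : nat) (V : {vspace 'rV[R]_d.+1}) : int :=
  (\dim V)%:Z - 1.

Definition rplane (R : realType) (d r : nat) : Type :=
  {X : {vspace 'rV[R]_d.+1} | pdim X == r%:Z}.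

Definition pspace (R : realType) (d r : nat) (X : rplane R d r) :
  {vspace 'rV[R]_d.+1} := val X.
Coercion pspace : rplane >-> space.

Section Zariski.
Variables (R : realType) (d r m : nat).

Definition basis_mx (X : rplane R d r) : 'M[R]_(r.+1, d.+1) :=
  \matrix_(i < r.+1) (vbasis X)`_i.

(* Pluecker coordinates are indexed by all maps J from rows to columns, not
   only the increasing ones.  The additional coordinates are 0 or, up to sign,
   equal to one of the usual ones, so they do not change which sets are cut out
   by homogeneous equations. *)
Definition pluecker (X : rplane R d r) (J : {ffun 'I_r.+1 -> 'I_d.+1}) : R :=
  \det (colsub J (basis_mx X)).

Definition pvar : finType := ('I_m * {ffun 'I_r.+1 -> 'I_d.+1})%type.

Definition ppoly := {mpoly R[#|pvar|]}.

Definition pcoord (s : m.-tuple (rplane R d r)) (v : 'I_#|pvar|) : R :=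
  pluecker (tnth s (enum_val v).1) (enum_val v).2.

Definition multihomogeneous (F : ppoly) : Prop :=
  exists e : 'I_m -> nat, forall mon : 'X_{1..#|pvar|}, mon \in msupp F ->
    forall k : 'I_m,
      (\sum_(v < #|pvar| | (enum_val v).1 == k) mon v)%N = e k.

(* The Zariski topology on the m-fold product of the Grassmannian, embedded by
   Pluecker in a product of m projective spaces.  The vanishing of a
   multihomogeneous F at [pcoord s] does not depend on the bases chosen in
   [basis_mx]. *)
Definition zariski_closed (Z : set (m.-tuple (rplane R d r))) : Prop :=
  exists2 S : set ppoly, (forall F, S F -> multihomogeneous F) &
    Z = [set s | forall F, S F -> F.@[pcoord s] = 0].

Definition zariski_open_in (P U : set (m.-tuple (rplane R d r))) : Prop :=
  exists2 Z, zariski_closed Z & U = P `&` ~` Z.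

Definition zariski_dense_in (P U : set (m.-tuple (rplane R d r))) : Prop :=
  U `<=` P /\ forall Z, zariski_closed Z -> U `<=` Z -> P `<=` Z.

End Zariski.

(* The order of the entries is X, X_1, X_2, X_3, X_12, X_13, X_23. *)
Definition septuples (R : realType) (d r : nat) :
    set (7.-tuple (rplane R d r)) :=
  [set s | exists X X1 X2 X3 X12 X13 X23 : rplane R d r,
    [/\ s = [tuple X; X1; X2; X3; X12; X13; X23],
        pdim (X + X1 + X2 + X3)%VS = (4 * r + 3)%N%:Z,
        (X12 <= X + X1 + X2)%VS,
        (X13 <= X + X1 + X3)%VS &
        (X23 <= X + X2 + X3)%VS]].

Arguments septuples : clear implicits.

(* Main.v *)
Require Import Defs.
From HB Require Import structures.
From mathcomp Require Import all_boot all_order all_algebra.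
From mathcomp Require Import classical_sets boolp reals.
From mathcomp Require Import perm mpoly.
From mathcomp Require Import zify.
Import Order.TTheory GRing.Theory Num.Theory.
Local Open Scope ring_scope.
Local Open Scope classical_set_scope.
Set Implicit Arguments.
Unset Strict Implicit.
Unset Printing Implicit Defensive.

(** Write n = r + 1 and pass to vector subspaces.  The spaces X, X_1, X_2, X_3
are independent, so they span a space W of dimension 4n which contains all the
X_ij.  Put Y_i = X_i + X_ij + X_ik.  Generically dim Y_i = 3n, and then
X_i + X_ij + X_ik + X_123 has dimension 3n exactly when X_123 lies in Y_i.
So X_123 must be an n-dimensional subspace of the intersection of Y_1, Y_2 and
Y_3.  Three subspaces of codimension n in W meet in dimension at least n; when
they meet in dimension n, the intersection is the one possible X_123.

The open set is therefore cut out by dim Y_i = 3n and by the dimension n of the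
triple intersection.  The second condition is a lower bound on a rank: by
[rank_triple_mx] the subspace of V + V formed from (y,y), (y',0), (0,y'') with
y, y', y'' in Y_1, Y_2, Y_3 has dimension
dim Y_1 + dim Y_2 + dim Y_3 - dim (Y_1 :&: Y_2 :&: Y_3),
so the condition reads that this dimension is at least 8n.

Openness.  All four conditions bound below the rank of a sum of linear images
of the given r-planes ([zariski_open_in_rank]).  Where the Pluecker coordinate
J of an r-plane with basis matrix M is nonzero, the rows of
adj(M_J) M form another basis, and by Cramer's rule ([adj_mul_minor]) the
entries of this matrix are themselves Pluecker coordinates.  Hence minors built
from its rows are multihomogeneous polynomials in the Pluecker coordinates.

Density ([zariski_dense_of_lines]).  Given any septuple p, keep X, X_1, X_2, X_3
and move the bases of the X_ij along straight lines to those of a septuple p'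
in the open set over the same X, X_1, X_2, X_3.  Almost all points of the line lie
in the open set, so a multihomogeneous F that vanishes on the open set gives a
polynomial in the parameter with infinitely many zeros; it vanishes at p too.

Such a p' exists over every independent X, X_1, X_2, X_3: if A, A_1, A_2, A_3 are
their basis matrices, take for X_ij the row space of A + A_i + A_j
([rank_witness_face], [witness_span]). *)

(** * Row spaces of matrices as vector subspaces *)

Section RowSpaces.
Variables (R : realType) (d : nat).

Definition rowspan m (M : 'M[R]_(m, d.+1)) : {vspace 'rV[R]_d.+1} :=
  limg (linfun (mulmxr M : 'rV[R]_m -> 'rV[R]_d.+1)).

Lemma mem_rowspan m (M : 'M_(m, d.+1)) (v : 'rV_d.+1) :
  (v \in rowspan M) = (v <= M)%MS.
Proof.
apply/memv_imgP/submxP => -[u]; last by exists u; rewrite ?memvf ?lfunE.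
by move=> _ ->; exists u; rewrite lfunE.
Qed.

Lemma rowspanS m1 m2 (M : 'M_(m1, d.+1)) (N : 'M_(m2, d.+1)) :
  (rowspan M <= rowspan N)%VS = (M <= N)%MS.
Proof.
apply/subvP/rV_subP => sMN v; first by rewrite -!mem_rowspan; apply: sMN.
by rewrite !mem_rowspan; apply: sMN.
Qed.

Lemma eq_rowspan m1 m2 (M : 'M_(m1, d.+1)) (N : 'M_(m2, d.+1)) :
  (M :=: N)%MS -> rowspan M = rowspan N.
Proof. by move=> eMN; apply/vspaceP => v; rewrite !mem_rowspan eMN. Qed.

Lemma dim_rowspan m (M : 'M_(m, d.+1)) : \dim (rowspan M) = \rank M.
Proof.
rewrite -(eq_rowspan (eq_row_base M)) limg_dim_eq; first by rewrite dimvf /dim /= mul1n.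
apply/eqP; rewrite -subv0; apply/subvP => u; rewrite memv_cap memvf /= memv_ker lfunE /=.
by rewrite memv0 mulmx_free_eq0 ?row_base_free.
Qed.

Lemma rowspanD m1 m2 (M : 'M_(m1, d.+1)) (N : 'M_(m2, d.+1)) :
  rowspan (M + N)%MS = (rowspan M + rowspan N)%VS.
Proof.
apply/eqP; rewrite eqEsubv; apply/andP; split; last first.
  by rewrite subv_add !rowspanS addsmxSl addsmxSr.
apply/subvP => v; rewrite mem_rowspan => /sub_addsmxP[u ->].
by apply: memv_add; rewrite mem_rowspan submxMl.
Qed.

Variable r : nat.

Lemma dim_rplane (X : rplane R d r) : \dim X = r.+1.
Proof. by have := valP X; rewrite /pdim subr_eq addrC -intS => /eqP[]. Qed.

Lemma rowspan_basis (X : rplane R d r) : rowspan (basis_mx X) = X :> {vspace _}.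
Proof.
apply/vspaceP => v; rewrite mem_rowspan; apply/idP/idP => [/submxP[u ->]|].
  rewrite mulmx_sum_row memv_suml // => i _; rewrite memvZ // rowK.
  by apply: vbasis_mem; rewrite mem_nth // size_tuple dim_rplane.
move=> Xv; rewrite (coord_vbasis Xv) summx_sub // => i _; rewrite scalemx_sub //.
have lt_i : (i < r.+1)%N by rewrite -(dim_rplane X).
by have /= := row_sub (Ordinal lt_i) (basis_mx X); rewrite rowK.
Qed.

Lemma rank_basis (X : rplane R d r) : \rank (basis_mx X) = r.+1.
Proof. by rewrite -dim_rowspan rowspan_basis dim_rplane. Qed.

Lemma rplane_of_mx m (M : 'M[R]_(m, d.+1)) : \rank M = r.+1 ->
  exists2 X : rplane R d r, X = rowspan M :> {vspace _} & (basis_mx X :=: M)%MS.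
Proof.
move=> rkM; have hX : pdim (rowspan M) == r%:Z.
  by rewrite /pdim dim_rowspan rkM intS addrC addKr.
exists (Sub (rowspan M) hX : rplane R d r) => //.
by apply/eqmxP; rewrite -!rowspanS rowspan_basis subvv.
Qed.
End RowSpaces.

(** * Multihomogeneous polynomials *)

Section Multihomogeneous.
Variables (R : realType) (d r m : nat).
Notation pol := (ppoly R d r m).
Implicit Types (F G : pol) (e : 'I_m -> nat).

Definition multidegree (mon : 'X_{1..#|pvar d r m|}) (k : 'I_m) : nat :=
  (\sum_(v < #|pvar d r m| | (enum_val v).1 == k) mon v)%N.

(** A boolean version of [multihomogeneous] with an explicit multidegree [e]; the
zero polynomial has every multidegree. *)
Definition mhomog e F : bool :=
  all (fun mon => [forall k, multidegree mon k == e k]) (msupp F).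

Lemma mhomogP e F :
  reflect (forall mon, mon \in msupp F -> multidegree mon =1 e) (mhomog e F).
Proof.
apply: (iffP allP) => hF mon /hF; first by move/forallP=> h k; apply/eqP.
by move=> h; apply/forallP => k; rewrite h.
Qed.

Lemma mhomog_multihomogeneous e F : mhomog e F -> multihomogeneous F.
Proof. by move/mhomogP; exists e. Qed.

Lemma eq_mhomog e1 e2 F : e1 =1 e2 -> mhomog e1 F -> mhomog e2 F.
Proof. by move=> e12 /mhomogP hF; apply/mhomogP => mon /hF h k; rewrite h. Qed.

Lemma mhomog_sum (I : Type) (s : seq I) (Q : pred I) (F : I -> pol) e :
  (forall i, Q i -> mhomog e (F i)) -> mhomog e (\sum_(i <- s | Q i) F i).
Proof.
move=> hF; elim/big_rec: _ => [|i G /hF/mhomogP hi /mhomogP hG].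
  by apply/mhomogP => mon; rewrite msupp0.
by apply/mhomogP => mon /msuppD_le; rewrite mem_cat => /orP[/hi|/hG].
Qed.

Lemma mhomogC c : mhomog (fun=> 0%N) c%:MP.
Proof.
apply/mhomogP => mon; rewrite msuppC; case: ifP => // _; rewrite inE => /eqP-> k.
by rewrite /multidegree big1 // => i _; rewrite mnm0E.
Qed.

Lemma mhomogM e1 e2 F G : mhomog e1 F -> mhomog e2 G ->
  mhomog (fun k => e1 k + e2 k)%N (F * G).
Proof.
move=> /mhomogP hF /mhomogP hG; apply/mhomogP => mon.
move=> /msuppM_le /allpairsP[[m1 m2] /= [/hF h1 /hG h2 ->]] k.
by rewrite -h1 -h2 -big_split; apply: eq_bigr => i _; rewrite mnmDE.
Qed.

Lemma mhomog_prod (I : Type) (s : seq I) (Q : pred I) (F : I -> pol) (e : I -> 'I_m -> nat) :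
  (forall i, Q i -> mhomog (e i) (F i)) ->
  mhomog (fun k => \sum_(i <- s | Q i) e i k)%N (\prod_(i <- s | Q i) F i).
Proof.
move=> hF; elim: s => [|i s IH].
  by rewrite big_nil -mpolyC1; apply: (eq_mhomog _ (mhomogC _)) => k; rewrite big_nil.
rewrite big_cons; case: ifP => Qi.
  by apply: (eq_mhomog _ (mhomogM (hF i Qi) IH)) => k; rewrite big_cons Qi.
by apply: (eq_mhomog _ IH) => k; rewrite big_cons Qi.
Qed.

(** Each permutation takes one entry from each row, so it is enough that the
multidegree of an entry depends on its row only. *)
Lemma mhomog_det n (A : 'M[pol]_n) (e : 'I_n -> 'I_m -> nat) :
  (forall i j, mhomog (e i) (A i j)) ->
  mhomog (fun k => \sum_(i < n) e i k)%N (\det A).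
Proof.
move=> hA; apply: mhomog_sum => s _; rewrite -[(-1) ^+ _](rmorph_sign (@mpolyC _ R)).
have hs := mhomog_prod (index_enum 'I_n) (Q := predT) (fun i _ => hA i (s i)).
by apply: eq_mhomog (mhomogM (mhomogC _) hs).
Qed.

Definition pcvar k J : pol := 'X_(enum_rank (k, J)).

Lemma mhomog_pcvar k J : mhomog (fun l => (l == k)%N) (pcvar k J).
Proof.
apply/mhomogP => mon; rewrite msuppX inE => /eqP-> l; rewrite /multidegree.
rewrite (eq_bigr (fun v => (enum_rank (k, J) == v) : nat)); last by move=> v _; rewrite mnm1E.
rewrite big_mkcond (bigD1 (enum_rank (k, J))) //= enum_rankK eqxx big1; last first.
  by move=> v; rewrite eq_sym => /negbTE->; rewrite if_same.
by rewrite addn0 eq_sym; case: eqP.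
Qed.

(** The factors [c k] come from a change of basis of the [k]-th plane, which
multiplies all of its Pluecker coordinates by one determinant. *)
Lemma mhomog_scale e F (c : 'I_m -> R) (x : 'I_#|pvar d r m| -> R) : mhomog e F ->
  F.@[fun v => c (enum_val v).1 * x v] = \prod_k c k ^+ e k * F.@[x].
Proof.
move=> /mhomogP hF; rewrite !mevalE mulr_sumr big_seq [RHS]big_seq.
apply: eq_bigr => mon /hF hm; rewrite mulrCA; congr (_ * _).
rewrite (eq_bigr (fun v => c (enum_val v).1 ^+ mon v * x v ^+ mon v)); last first.
  by move=> v _; rewrite exprMn.
rewrite big_split; congr (_ * _).
rewrite (partition_big (fun v => (enum_val v).1) predT) //=.
apply: eq_bigr => k _; rewrite -hm /multidegree -prodrXr; apply: eq_bigr => v /eqP->//.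
Qed.

End Multihomogeneous.
Arguments mhomogC {R d r m} c.

(** * Selecting rows and minors *)

Lemma poly_eq0_everywhere (R : numDomainType) (p : {poly R}) :
  (forall t, p.[t] = 0) -> p = 0.
Proof.
move=> p0; pose rs := [seq i%:R : R | i <- iota 0 (size p)].
apply: (@roots_geq_poly_eq0 _ p rs); last by rewrite size_map size_iota.
  by apply/allP => x _; apply/rootP.
by rewrite map_inj_uniq ?iota_uniq // => i j /eqP; rewrite eqr_nat => /eqP.
Qed.

(** A rank bound is witnessed by single rows, each of which comes from one of the
summands.  This is what keeps the minors of [chart_minor] multihomogeneous: a row of the
minor involves one plane only. *)
Lemma sumsmx_row_free (F : fieldType) (I : finType) n D q (A : I -> 'M[F]_(n, D)) :
  (q <= \rank (\sum_a <<A a>>)%MS)%N ->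
  exists f : 'I_q -> I * 'I_n, row_free (\matrix_i row (f i).2 (A (f i).1)).
Proof.
pose T := \matrix_(x < #|{: I * 'I_n}|) row (enum_val x).2 (A (enum_val x).1).
have sAT : (\sum_a <<A a>> <= T)%MS.
  apply/sumsmx_subP => a _; rewrite genmxE; apply/row_subP => i.
  by have := row_sub (enum_rank (a, i)) T; rewrite rowK enum_rankK.
move=> /leq_trans/(_ (mxrankS sAT)) le_q.
pose g i := widen_ord le_q i; exists (fun i => enum_val (maxrankfun T (g i))).
have -> : \matrix_i row (enum_val (maxrankfun T (g i))).2
              (A (enum_val (maxrankfun T (g i))).1) =
          rowsub g (rowsub (maxrankfun T) T).
  by apply/matrixP => i j; rewrite !mxE.
have /row_freeP[B TB] := maxrowsub_free T.
apply/row_freeP; exists (B *m colsub g 1%:M).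
rewrite mulmxA mul_rowsub_mx TB mulmx_colsub mulmx1.
by apply/matrixP => i j; rewrite !mxE -val_eqE.
Qed.

Lemma row_free_minor (F : fieldType) n d (M : 'M[F]_(n, d)) : row_free M ->
  exists J : {ffun 'I_n -> 'I_d}, \det (colsub J M) != 0.
Proof.
move=> fM; have fMT : row_full M^T by rewrite /row_full mxrank_tr.
exists (fullrankfun fMT).
have -> : colsub (fullrankfun fMT) M = (rowsub (fullrankfun fMT) M^T)^T.
  by apply/matrixP => i j; rewrite !mxE.
by rewrite det_tr -unitfE -unitmxE fullrowsub_unit.
Qed.

(** * Pluecker coordinates as entries of a basis *)

Section Cramer.
Variables (S : comNzRingType) (n d : nat).

Definition subst_col (J : {ffun 'I_n -> 'I_d}) i c : {ffun 'I_n -> 'I_d} :=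
  [ffun j => if j == i then c else J j].

(** Cramer's rule.  With [M] a basis matrix this says that, up to the factor
[\adj (colsub J M)], Pluecker coordinates are the entries of a basis matrix. *)
Lemma adj_mul_minor (J : {ffun 'I_n -> 'I_d}) (M : 'M[S]_(n, d)) i c :
  (\adj (colsub J M) *m M) i c = \det (colsub (subst_col J i c) M).
Proof.
rewrite mxE (expand_det_col _ i); apply: eq_bigr => j _.
rewrite !mxE ffunE eqxx mulrC; congr (_ * (_ * \det _)).
apply/matrixP => k l; rewrite !mxE ffunE.
by rewrite eq_sym (negbTE (neq_lift _ _)).
Qed.
End Cramer.

(** * Zariski topology on products of Grassmannians *)

Section Coordinates.
Variables (R : realType) (d r m : nat).
Notation pol := (ppoly R d r m).
Notation tup := (m.-tuple (rplane R d r)).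

(** The Pluecker coordinates of arbitrary spanning matrices rather than of the
chosen bases; the ring may be [{poly R}], for planes that move with a parameter. *)
Definition mcoord (S : comNzRingType) (M : 'I_m -> 'M[S]_(r.+1, d.+1))
    (v : 'I_#|pvar d r m|) : S :=
  \det (colsub (enum_val v).2 (M (enum_val v).1)).

Lemma horner_mcoord (M : 'I_m -> 'M[{poly R}]_(r.+1, d.+1)) v t :
  (mcoord M v).[t] = mcoord (fun k => map_mx (horner_eval t) (M k)) v.
Proof. by rewrite -horner_evalE -det_map_mx map_mxsub. Qed.

(** Two bases of a plane differ by an invertible matrix, so their coordinates
differ by a nonzero factor that a multihomogeneous polynomial pulls out. *)
Lemma meval_mcoord_eq0 e (F : pol) (M : 'I_m -> 'M[R]_(r.+1, d.+1)) (s : tup) :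
  mhomog e F -> (forall k, (basis_mx (tnth s k) :=: M k)%MS) ->
  (F.@[mcoord M] == 0) = (F.@[pcoord s] == 0).
Proof.
move=> hF eM; pose C k := M k *m pinvmx (basis_mx (tnth s k)).
have MC k : M k = C k *m basis_mx (tnth s k) by rewrite mulmxKpV // eM.
have C_neq0 k : \det (C k) != 0.
  rewrite -unitfE -unitmxE -row_free_unit -row_leq_rank.
  by rewrite -{1}(rank_basis (tnth s k)) eM {1}MC mxrankM_maxl.
rewrite (meval_eq (v2 := fun v => \det (C (enum_val v).1) * pcoord s v)); last first.
  by move=> v; rewrite /mcoord MC -mulmx_colsub det_mulmx.
rewrite (mhomog_scale (fun k => \det (C k)) _ hF) mulf_eq0.
have /negbTE-> // : \prod_k \det (C k) ^+ e k != 0.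
by apply/prodf_neq0 => k _; rewrite expf_neq0.
Qed.

Lemma basis_minors (s : tup) : exists J : 'I_m -> {ffun 'I_r.+1 -> 'I_d.+1},
  forall k, \det (colsub (J k) (basis_mx (tnth s k))) != 0.
Proof.
apply: (@fin_all_exists _ (fun=> {ffun 'I_r.+1 -> 'I_d.+1})
  (fun k J => \det (colsub J (basis_mx (tnth s k))) != 0)) => k.
by apply: row_free_minor; rewrite -row_leq_rank rank_basis.
Qed.

Section RankLocus.
Variables (I : finType) (D q : nat) (kap : I -> 'I_m) (L : I -> 'M[R]_(d.+1, D)).
Implicit Types (J : 'I_m -> {ffun 'I_r.+1 -> 'I_d.+1}) (f : 'I_q -> I * 'I_r.+1).

Definition image_sum (s : tup) : 'M[R]_D :=
  (\sum_a <<basis_mx (tnth s (kap a)) *m L a>>)%MS.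

(** The matrix of variables which, at the coordinates of a plane, becomes the
basis of [adj_mul_minor]. *)
Definition chart_mx J k : 'M[pol]_(r.+1, d.+1) :=
  \matrix_(i, c) pcvar R k (subst_col (J k) i c).

(** The determinant detects [q] independent rows among the images of the charts.
The product in front makes the polynomial vanish wherever one of the charts is
not a basis of its plane.  The matrix [Q] plays the role of a choice of columns. *)
Definition chart_minor J f (Q : 'M[R]_(D, q)) : pol :=
  (\prod_k pcvar R k (J k)) *
  \det (\matrix_i (row (f i).2 (chart_mx J (kap (f i).1)) *m map_mx (@mpolyC _ R) (L (f i).1))
        *m map_mx (@mpolyC _ R) Q).

(** Row [i] of the determinant has degree one in the coordinates of the plane that
it comes from and degree zero in the others. *)
Lemma multihomogeneous_chart_minor J f Q : multihomogeneous (chart_minor J f Q).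
Proof.
have hentry k i n (B : 'M[R]_(d.+1, n)) j :
    mhomog (fun l => (l == k)%N) ((row i (chart_mx J k) *m map_mx (@mpolyC _ R) B) 0 j).
  rewrite mxE; apply: mhomog_sum => c _; rewrite !mxE.
  by apply: (eq_mhomog _ (mhomogM (mhomog_pcvar R _ _) (mhomogC _))) => l; rewrite addn0.
have hprod := mhomog_prod (index_enum 'I_m) (Q := predT)
  (fun k _ => mhomog_pcvar R k (J k)).
apply: mhomog_multihomogeneous (mhomogM hprod _).
apply: (mhomog_det (e := fun i l => (l == kap (f i).1) : nat)).
move=> i j; rewrite mxE; apply: mhomog_sum => c _; rewrite mxE [X in _ * X]mxE.
by apply: (eq_mhomog _ (mhomogM (hentry _ _ _ _ _) (mhomogC _))) => l; rewrite addn0.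
Qed.

Definition adj_basis (s : tup) J k : 'M[R]_(r.+1, d.+1) :=
  \adj (colsub (J k) (basis_mx (tnth s k))) *m basis_mx (tnth s k).

Lemma meval_chart_minor (s : tup) J f Q :
  (chart_minor J f Q).@[pcoord s] =
  (\prod_k \det (colsub (J k) (basis_mx (tnth s k)))) *
  \det (\matrix_i (row (f i).2 (adj_basis s J (kap (f i).1) *m L (f i).1)) *m Q).
Proof.
have hX k K : (pcvar R k K).@[pcoord s] = \det (colsub K (basis_mx (tnth s k))).
  by rewrite mevalXU /pcoord enum_rankK.
rewrite mevalM rmorph_prod -det_map_mx map_mxM /=.
congr (_ * _); last congr (\det _); last congr mulmx.
- by apply: eq_bigr => k _; rewrite hX.
- apply/matrixP => i j; rewrite !mxE rmorph_sum; apply: eq_bigr => c _.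
  by rewrite !mxE rmorphM /= mevalC hX -adj_mul_minor mxE.
- by apply/matrixP => i j; rewrite !mxE mevalC.
Qed.

Lemma adj_basis_eqmx (s : tup) J k :
  \det (colsub (J k) (basis_mx (tnth s k))) != 0 ->
  (adj_basis s J k :=: basis_mx (tnth s k))%MS.
Proof.
move=> J_neq0; apply: eqmxMfull; rewrite row_full_unit unitmxE unitfE.
set N := colsub _ _ in J_neq0 *.
have /(congr1 determinant) := mul_adj_mx N; rewrite det_mulmx det_scalar => eN.
by apply/eqP => N0; move/eqP: eN; rewrite N0 mul0r eq_sym expf_eq0 (negbTE J_neq0) andbF.
Qed.

(** The polynomials [chart_minor] are the equations.  If the rank is at least [q],
choose for each plane a nonzero Pluecker coordinate, then [q] independent rows, then
a right inverse [Q] of these rows: one equation fails. *)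
Lemma zariski_closed_low_rank :
  zariski_closed [set s : tup | ~~ (q <= \rank (image_sum s))%N].
Proof.
exists [set F | exists J f Q, F = chart_minor J f Q].
  by move=> _ [J [f [Q ->]]]; apply: multihomogeneous_chart_minor.
apply/seteqP; split=> s /=.
  move=> low _ [J [f [Q ->]]]; apply/eqP/contraT; rewrite meval_chart_minor mulf_eq0.
  rewrite negb_or => /andP[/prodf_neq0 J_neq0 det_neq0]; case/negP: low.
  set T := \matrix_i _ in det_neq0; have fT : row_free T.
    rewrite -row_leq_rank (leq_trans _ (mxrankM_maxl _ Q)) // row_leq_rank.
    by rewrite row_free_unit unitmxE unitfE.
  rewrite -(eqP fT) mxrankS //; apply/row_subP => i; rewrite rowK.
  apply: submx_trans (row_sub _ _) _; apply: (sumsmx_sup (f i).1) => //.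
  by rewrite genmxE (eqmxMr _ (adj_basis_eqmx (J_neq0 _ _))).
move=> vanish; apply/negP => high.
have [J J_neq0] := basis_minors s.
have [f ff] : exists f : 'I_q -> I * 'I_r.+1,
    row_free (\matrix_i row (f i).2 (adj_basis s J (kap (f i).1) *m L (f i).1)).
  apply: (@sumsmx_row_free _ _ _ _ _ (fun a => adj_basis s J (kap a) *m L a)).
  rewrite (leq_trans high) // mxrankS // /image_sum; apply/sumsmx_subP => a _.
  rewrite (sumsmx_sup a) // !genmxE (eqmxMr _ (adj_basis_eqmx _)) //.
have := vanish _ (ex_intro _ J (ex_intro _ f (ex_intro _ (pinvmx _) erefl))).
move=> /(_ (\matrix_i row (f i).2 (adj_basis s J (kap (f i).1) *m L (f i).1))) /eqP.
rewrite meval_chart_minor mulmxVp // det1 mulr1; apply/negP.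
by apply/prodf_neq0 => k _.
Qed.
End RankLocus.

Lemma zariski_closedU (Z1 Z2 : set tup) :
  zariski_closed Z1 -> zariski_closed Z2 -> zariski_closed (Z1 `|` Z2).
Proof.
move=> [S1 h1 ->] [S2 h2 ->].
exists [set H | exists F G, [/\ S1 F, S2 G & H = F * G]].
  move=> _ [F [G [/h1[e1 /mhomogP hF] /h2[e2 /mhomogP hG] ->]]].
  exact: mhomog_multihomogeneous (mhomogM hF hG).
apply/seteqP; split=> s /=.
  case=> h _ [F [G [S1F S2G ->]]]; rewrite mevalM.
    by rewrite (h F S1F) mul0r.
  by rewrite (h G S2G) mulr0.
move=> hs; case: (pselect (forall F, S1 F -> F.@[pcoord s] = 0)) => [|n1]; [by left|right].
move=> G S2G; apply/eqP/contraT => G_neq0; exfalso; apply: n1 => F S1F.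
have /eqP := hs _ (ex_intro _ F (ex_intro _ G (And3 S1F S2G erefl))).
by rewrite mevalM mulf_eq0 (negbTE G_neq0) orbF => /eqP.
Qed.

Lemma zariski_open_inI (P U1 U2 : set tup) :
  zariski_open_in P U1 -> zariski_open_in P U2 -> zariski_open_in P (U1 `&` U2).
Proof.
move=> [Z1 cZ1 ->] [Z2 cZ2 ->]; exists (Z1 `|` Z2); first exact: zariski_closedU.
by rewrite setCU setIACA setIid.
Qed.

Lemma zariski_open_in_rank (P : set tup) (I : finType) D q (kap : I -> 'I_m)
    (L : I -> 'M[R]_(d.+1, D)) :
  zariski_open_in P (P `&` [set s | (q <= \rank (image_sum kap L s))%N]).
Proof.
exists [set s : tup | ~~ (q <= \rank (image_sum kap L s))%N].
  exact: zariski_closed_low_rank.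
by congr (_ `&` _); apply/seteqP; split=> s /= => [->|/negP]; rewrite ?negbK.
Qed.

Lemma horner_mmap n (F : {mpoly R[n]}) (h : 'I_n -> {poly R}) t :
  (mmap polyC h F).[t] = F.@[fun v => (h v).[t]].
Proof.
rewrite mevalE /mmap horner_sum; apply: eq_bigr => mon _.
rewrite hornerM hornerC horner_prod; congr (_ * _).
by apply: eq_bigr => v _; rewrite horner_exp.
Qed.

(** The straight line between the chosen bases, rather than between points of the
Pluecker embedding, so that containment of planes is preserved along it. *)
Definition line_to (p p' : tup) t k : 'M[R]_(r.+1, d.+1) :=
  basis_mx (tnth p k) + t *: (basis_mx (tnth p' k) - basis_mx (tnth p k)).

(** Along the line, a form [F] vanishing on [U], a form [G] that is nonzero at [p'] and
vanishes on [P] outside [U], and a product [h] of minors that is nonzero at [p] become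
polynomials in [t].  Wherever [G] and [h] do not vanish the matrices are bases of
planes forming a point of [U], so [F] vanishes there.  Thus the product of the
three is 0, and only the factor of [F] can be 0. *)
Lemma zariski_dense_of_lines (P U : set tup) : zariski_open_in P U ->
  (forall p, P p -> exists2 p', U p' & forall t s,
     (forall k, (basis_mx (tnth s k) :=: line_to p p' t k)%MS) -> P s) ->
  zariski_dense_in P U.
Proof.
move=> [Z [S hS ->] ->] lines; split=> [s []//|_ [S' hS' ->] sUZ' p Pp F S'F].
have [p' [Pp' nZp'] onP] := lines p Pp.
have [G SG G_neq0] : exists2 G, S G & G.@[pcoord p'] != 0.
  apply: contrapT => no; apply: nZp' => G SG; apply/eqP/contraT => G_neq0.
  by case: no; exists G.
have [eF /mhomogP hF] := hS' _ S'F; have [eG /mhomogP hG] := hS _ SG.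
have [J J_neq0] := basis_minors p.
pose M k : 'M[{poly R}]_(r.+1, d.+1) := map_mx polyC (basis_mx (tnth p k)) +
  'X *: map_mx polyC (basis_mx (tnth p' k) - basis_mx (tnth p k)).
have Mt t k : map_mx (horner_eval t) (M k) = line_to p p' t k.
  by apply/matrixP => i j; rewrite !mxE /horner_eval !hornerE mulrC.
have evalM (H : pol) t : (mmap polyC (mcoord M) H).[t] = H.@[mcoord (line_to p p' t)].
  rewrite horner_mmap; apply: meval_eq => v; rewrite horner_mcoord /mcoord.
  by rewrite Mt.
pose h := \prod_k \det (colsub (J k) (M k)).
have ht t : h.[t] = \prod_k \det (colsub (J k) (line_to p p' t k)).
  rewrite horner_prod; apply: eq_bigr => k _.
  by rewrite -horner_evalE -det_map_mx map_mxsub Mt.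
have line0 : line_to p p' 0 =1 (fun k => basis_mx (tnth p k)).
  by move=> k; rewrite /line_to scale0r addr0.
have line1 : line_to p p' 1 =1 (fun k => basis_mx (tnth p' k)).
  by move=> k; rewrite /line_to scale1r addrC subrK.
(* [h] is nonzero since its value at 0 is, and [G] because of its value at 1. *)
have h_neq0 : h != 0.
  apply/eqP => h0; have := ht 0; rewrite h0 horner0 => /esym/eqP; apply/negP.
  by apply/prodf_neq0 => k _; rewrite line0.
have g_neq0 : mmap polyC (mcoord M) G != 0.
  apply: contraNneq G_neq0 => g0; have := evalM G 1; rewrite g0 horner0 => /esym/eqP.
  by rewrite (meval_mcoord_eq0 (s := p') hG) // => k; rewrite line1.
have : mmap polyC (mcoord M) F * mmap polyC (mcoord M) G * h = 0.
  apply: poly_eq0_everywhere => t; rewrite !hornerM !evalM ht.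
  have [->|/prodf_neq0 ft] := eqVneq (\prod_k \det (colsub (J k) (line_to p p' t k))) 0.
    by rewrite mulr0.
  have [X hX] : exists X : 'I_m -> rplane R d r,
      forall k, (basis_mx (X k) :=: line_to p p' t k)%MS.
    apply: (@fin_all_exists _ (fun=> rplane R d r)
      (fun k X => (basis_mx X :=: line_to p p' t k)%MS)) => k.
    have [|X _ eX] := @rplane_of_mx _ _ r _ (line_to p p' t k).
      apply/eqP; rewrite eqn_leq rank_leq_row /=.
      rewrite -{1}(mxrank_unit (_ : colsub (J k) (line_to p p' t k) \in unitmx)).
        by rewrite -[X in colsub _ X]mulmx1 -mulmx_colsub mxrankM_maxl.
      by rewrite unitmxE unitfE ft.
    by exists X.
  pose s : tup := [tuple X k | k < m].
  have es k : (basis_mx (tnth s k) :=: line_to p p' t k)%MS by rewrite tnth_mktuple.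
  have Ps := onP t s es.
  have [Zs|nZs] := pselect (forall H, S H -> H.@[pcoord s] = 0).
    have /eqP := Zs _ SG; rewrite -(meval_mcoord_eq0 hG es) => /eqP->.
    by rewrite mulr0 mul0r.
  have /eqP := sUZ' s (conj Ps nZs) F S'F.
  by rewrite -(meval_mcoord_eq0 hF es) => /eqP->; rewrite !mul0r.
move/eqP; rewrite !mulf_eq0 (negbTE g_neq0) (negbTE h_neq0) !orbF => /eqP f0.
have := evalM F 0; rewrite f0 horner0 => /esym/eqP.
rewrite (meval_mcoord_eq0 (s := p) hF); first by move/eqP.
by move=> k; rewrite line0.
Qed.

End Coordinates.

(** * The dimension of a triple intersection *)

Section TripleIntersection.
Variables (F : fieldType) (D : nat).

Definition inl_mx : 'M[F]_(D, D + D) := row_mx 1%:M 0.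
Definition inr_mx : 'M[F]_(D, D + D) := row_mx 0 1%:M.
Definition dup_mx : 'M[F]_(D, D + D) := row_mx 1%:M 1%:M.

Definition triple_mx m1 m2 m3 (Y1 : 'M[F]_(m1, D)) (Y2 : 'M_(m2, D))
    (Y3 : 'M_(m3, D)) : 'M_(D + D) :=
  (Y1 *m dup_mx + Y2 *m inl_mx + Y3 *m inr_mx)%MS.

Lemma rank_inlD m1 m2 (Y : 'M[F]_(m1, D)) (Z : 'M_(m2, D)) :
  \rank (Y *m inl_mx + Z *m inr_mx)%MS = (\rank Y + \rank Z)%N.
Proof.
rewrite addsmxE !mul_mx_row !mulmx1 !mulmx0.
exact: rank_diag_block_mx.
Qed.

(** Apply the dimension formula to [Y1 *m dup_mx] and [Y2 *m inl_mx + Y3 *m inr_mx]: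
a pair (y,y) of the first space lies in the second exactly when y lies in the
triple intersection. *)
Lemma rank_triple_mx m1 m2 m3 (Y1 : 'M[F]_(m1, D)) (Y2 : 'M_(m2, D)) (Y3 : 'M_(m3, D)) :
  (\rank (triple_mx Y1 Y2 Y3) + \rank (Y1 :&: Y2 :&: Y3)%MS =
   \rank Y1 + \rank Y2 + \rank Y3)%N.
Proof.
have fdup : row_free dup_mx.
  by apply/row_freeP; exists (col_mx 1%:M 0); rewrite mul_row_col mulmx1 mulmx0 addr0.
rewrite /triple_mx -(addsmxA (Y1 *m _)) -addnA -(rank_inlD Y2 Y3) -(mxrankMfree Y1 fdup).
rewrite -mxrank_sum_cap -(mxrankMfree _ fdup); congr (_ + _)%N; apply: eqmx_rank.
apply/andP; split.
  (* The pair (y,y) is (y,0) + (0,y). *)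
  rewrite sub_capmx submxMr ?(submx_trans (capmxSl _ _)) ?capmxSl //=.
  have -> : dup_mx = inl_mx + inr_mx by rewrite add_row_mx addr0 add0r.
  rewrite mulmxDr addmx_sub_adds ?submxMr ?capmxSr //.
  by rewrite (submx_trans (capmxSl _ _)) ?capmxSr.
set K := (_ :&: _)%MS.
have /submxP[u eK] : (K <= Y1 *m dup_mx)%MS by apply: capmxSl.
have /sub_addsmxP[[a b] /= eK'] : (K <= Y2 *m inl_mx + Y3 *m inr_mx)%MS by apply: capmxSr.
rewrite {1}eK !mul_mx_row !mulmx1 !mulmx0 add_row_mx addr0 add0r in eK'.
case/eq_row_mx: eK' => ea eb; rewrite eK mulmxA submxMr // !sub_capmx submxMl.
by rewrite {1}ea eb !submxMl.
Qed.

(** Together with [rank_triple_mx] this bounds the triple intersection below. *)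
Lemma triple_mx_sub m1 m2 m3 m (Y1 : 'M[F]_(m1, D)) (Y2 : 'M_(m2, D))
    (Y3 : 'M_(m3, D)) (W : 'M_(m, D)) :
  (Y1 <= W)%MS -> (Y2 <= W)%MS -> (Y3 <= W)%MS ->
  (\rank (triple_mx Y1 Y2 Y3) <= \rank W + \rank W)%N.
Proof.
move=> s1 s2 s3; rewrite -rank_inlD mxrankS // !addsmx_sub.
have -> : dup_mx = inl_mx + inr_mx by rewrite add_row_mx addr0 add0r.
rewrite mulmxDr addmx_sub_adds ?submxMr //=.
by rewrite (submx_trans _ (addsmxSl _ _)) ?(submx_trans _ (addsmxSr _ _)) ?submxMr.
Qed.

(** The triple space contains (y,0) for y in [Y2], and also for y in both [Y1] and [Y3],
since (y,0) = (y,y) - (0,y).  Symmetrically on the right. *)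
Lemma sub_triple_mx m1 m2 m3 m (Y1 : 'M[F]_(m1, D)) (Y2 : 'M_(m2, D))
    (Y3 : 'M_(m3, D)) (W : 'M_(m, D)) :
  (W <= Y2 + (Y1 :&: Y3))%MS -> (W <= Y3 + (Y1 :&: Y2))%MS ->
  (\rank W + \rank W <= \rank (triple_mx Y1 Y2 Y3))%N.
Proof.
move=> sl sr; rewrite -rank_inlD mxrankS // addsmx_sub; apply/andP.
have hdup m4 (K : 'M_(m4, D)) : (K <= Y1)%MS -> (K *m dup_mx <= triple_mx Y1 Y2 Y3)%MS.
  move=> sK; apply: submx_trans (addsmxSl _ _); apply: submx_trans (addsmxSl _ _).
  exact: submxMr.
have hl m4 (K : 'M_(m4, D)) : (K <= Y2)%MS -> (K *m inl_mx <= triple_mx Y1 Y2 Y3)%MS.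
  move=> sK; apply: submx_trans (addsmxSl _ _); apply: submx_trans (addsmxSr _ _).
  exact: submxMr.
have hr m4 (K : 'M_(m4, D)) : (K <= Y3)%MS -> (K *m inr_mx <= triple_mx Y1 Y2 Y3)%MS.
  by move=> sK; apply: submx_trans (addsmxSr _ _); apply: submxMr.
have el : inl_mx = dup_mx - inr_mx by rewrite opp_row_mx add_row_mx oppr0 addr0 subrr.
have er : inr_mx = dup_mx - inl_mx by rewrite opp_row_mx add_row_mx oppr0 addr0 subrr.
split; [apply: submx_trans (submxMr _ sl) _|apply: submx_trans (submxMr _ sr) _].
  rewrite addsmxMr addsmx_sub hl //= {1}el mulmxBr addmx_sub ?eqmx_opp ?hdup ?hr //.
    exact: capmxSl.
  exact: capmxSr.
rewrite addsmxMr addsmx_sub hr //= {1}er mulmxBr addmx_sub ?eqmx_opp ?hdup ?hl //.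
  exact: capmxSl.
exact: capmxSr.
Qed.
End TripleIntersection.

(** * A septuple in general position *)

Section Witness.
Variables (F : fieldType) (n D : nat).
Implicit Types A : 'M[F]_(n, D).

Lemma submx_addKr m A A1 (Y : 'M[F]_(m, D)) :
  ((A + A1)%R <= Y)%MS -> (A1 <= Y)%MS -> (A <= Y)%MS.
Proof. by move=> s01 s1; rewrite -(addrK A1 A) addmx_sub ?eqmx_opp. Qed.

Lemma sub_sum4 m A A1 A2 A3 (Y : 'M[F]_(m, D)) :
  (A <= Y)%MS -> (A1 <= Y)%MS -> (A2 <= Y)%MS -> (A3 <= Y)%MS ->
  (A + A1 + A2 + A3 <= Y)%MS.
Proof. by move=> s0 s1 s2 s3; rewrite !addsmx_sub s0 s1 s2 s3. Qed.

(** Adjoining the three spaces of [A1], [A2], [A3] recovers the whole sum, of rank [4 * n],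
and adds at most [3 * n] to the rank. *)
Lemma rank_witness A A1 A2 A3 : \rank (A + A1 + A2 + A3)%MS = (4 * n)%N ->
  \rank (A + A1 + A2)%R = n.
Proof.
move=> rW; apply/eqP; rewrite eqn_leq rank_leq_row.
set Z := (_ + _)%R; have sW : (A + A1 + A2 + A3 <= Z + A1 + A2 + A3)%MS.
  have s1 : (A1 <= Z + A1 + A2 + A3)%MS.
    by do 2!apply: submx_trans (addsmxSl _ _); apply: addsmxSr.
  have s2 : (A2 <= Z + A1 + A2 + A3)%MS.
    by apply: submx_trans (addsmxSl _ _); apply: addsmxSr.
  apply: sub_sum4 => //; last exact: addsmxSr.
  apply: (submx_addKr _ s1); apply: (submx_addKr _ s2).
  by do 3!apply: submx_trans (addsmxSl _ _).
have := mxrankS sW; rewrite rW.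
have := (mxrank_adds_leqif (Z + A1 + A2)%MS A3).1.
have := (mxrank_adds_leqif (Z + A1)%MS A2).1.
have := (mxrank_adds_leqif Z A1).1.
have := rank_leq_row A1; have := rank_leq_row A2; have := rank_leq_row A3.
by lia.
Qed.

(** Adjoining [A] recovers the whole sum, and adds at most [n] to the rank. *)
Lemma rank_witness_face m m' A A1 A2 A3 (Z : 'M_(m, D)) (Z' : 'M_(m', D)) :
  \rank (A + A1 + A2 + A3)%MS = (4 * n)%N ->
  ((A + A1 + A2)%R <= Z)%MS -> ((A + A1 + A3)%R <= Z')%MS ->
  (3 * n <= \rank (A1 + Z + Z')%MS)%N.
Proof.
move=> rW sZ sZ'; set Y := (A1 + Z + Z')%MS.
have s1 : (A1 <= Y + A)%MS by do 2!apply: submx_trans (addsmxSl _ _); apply: addsmxSl.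
have sA : (A <= Y + A)%MS by apply: addsmxSr.
have s01 : ((A + A1)%R <= Y + A)%MS by apply: addmx_sub.
have sW : (A + A1 + A2 + A3 <= Y + A)%MS.
  apply: sub_sum4 => //; apply: (submx_addKr _ s01); rewrite addrC.
    apply: submx_trans sZ _; apply: submx_trans (addsmxSl _ _).
    by apply: submx_trans (addsmxSl _ _); apply: addsmxSr.
  by apply: submx_trans sZ' _; apply: submx_trans (addsmxSl _ _); apply: addsmxSr.
have := mxrankS sW; rewrite rW; have := (mxrank_adds_leqif Y A).1.
by have := rank_leq_row A; lia.
Qed.

(** The rows of [A + A2 = (A + A1 + A2) - A1 = (A + A2 + A3) - A3] lie in [Y1] and [Y3].
Subtracting [A2], which lies in [Y2], leaves [A]; from [A] and [A2] the remaining rows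
of [Y2] give [A1] and [A3]. *)
Lemma witness_span m1 m2 m3 A A1 A2 A3 (Y1 : 'M_(m1, D)) (Y2 : 'M_(m2, D))
    (Y3 : 'M_(m3, D)) :
  (A1 <= Y1)%MS -> (A2 <= Y2)%MS -> (A3 <= Y3)%MS ->
  ((A + A1 + A2)%R <= Y1)%MS -> ((A + A1 + A2)%R <= Y2)%MS ->
  ((A + A2 + A3)%R <= Y2)%MS -> ((A + A2 + A3)%R <= Y3)%MS ->
  (A + A1 + A2 + A3 <= Y2 + (Y1 :&: Y3))%MS.
Proof.
move=> s11 s22 s33 s121 s122 s232 s233.
have lift2 (C : 'M_(n, D)) : (C <= Y2)%MS -> (C <= Y2 + (Y1 :&: Y3))%MS.
  by move=> sC; apply: submx_trans (addsmxSl _ _).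
have s02 : ((A + A2)%R <= Y2 + (Y1 :&: Y3))%MS.
  apply: submx_trans (addsmxSr _ _); rewrite sub_capmx.
  by rewrite (submx_addKr _ s11) 1?addrAC // (submx_addKr _ s33).
have s2 := lift2 _ s22; have s0 := submx_addKr s02 s2.
apply: sub_sum4 => //; apply: (submx_addKr _ s02); rewrite addrC.
  by rewrite addrAC lift2.
by rewrite lift2.
Qed.
End Witness.

(** * The generic septuples *)

Local Notation i1 := (@Ordinal 3 0 isT).
Local Notation i2 := (@Ordinal 3 1 isT).
Local Notation i3 := (@Ordinal 3 2 isT).
Local Notation p0 := (@Ordinal 7 0 isT).
Local Notation p1 := (@Ordinal 7 1 isT).
Local Notation p2 := (@Ordinal 7 2 isT).
Local Notation p3 := (@Ordinal 7 3 isT).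
Local Notation p4 := (@Ordinal 7 4 isT).
Local Notation p5 := (@Ordinal 7 5 isT).
Local Notation p6 := (@Ordinal 7 6 isT).

Section Septuples.
Variables (R : realType) (d r : nat).
Notation B := (@basis_mx R d r).
Implicit Types (s : 7.-tuple (rplane R d r)).

(** The positions in the septuple of the planes X_i, X_ij, X_ik that span Y_i. *)
Definition face_ix (i j : 'I_3) : 'I_7 :=
  nth ord0 (nth [::] [:: [:: p1; p4; p5];
                         [:: p2; p4; p6];
                         [:: p3; p5; p6]] i) j.

(** The maps from V to V + V under which Y_1, Y_2, Y_3 enter [triple_mx]. *)
Definition slot (i : 'I_3) : 'M[R]_(d.+1, d.+1 + d.+1) :=
  nth 0 [:: dup_mx R d.+1; inl_mx R d.+1; inr_mx R d.+1] i.

Definition face i s := image_sum (face_ix i) (fun=> 1%:M) s.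
Definition faces s :=
  image_sum (fun a : 'I_3 * 'I_3 => face_ix a.1 a.2) (fun a => slot a.1) s.

Lemma sum3_eqmx n D (V : 'I_3 -> 'M[R]_(n, D)) :
  (\sum_j <<V j>> :=: V i1 + V i2 + V i3)%MS.
Proof.
apply/eqmxP/andP; split.
  apply/sumsmx_subP => j _; rewrite genmxE.
  case: j => [[|[|[|//]]] lt_j].
  - rewrite (bool_irrelevance lt_j isT) (submx_trans _ (addsmxSl _ _)) //.
    exact: addsmxSl.
  - rewrite (bool_irrelevance lt_j isT) (submx_trans _ (addsmxSl _ _)) //.
    exact: addsmxSr.
  - by rewrite (bool_irrelevance lt_j isT) addsmxSr.
by rewrite !addsmx_sub; do !(apply/andP; split);
  (apply: submx_trans (sumsmx_sup _ _ (submx_refl _)); rewrite ?genmxE).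
Qed.

Lemma faces_eqmx s :
  (faces s :=: triple_mx (face i1 s) (face i2 s)
                         (face i3 s))%MS.
Proof.
rewrite /triple_mx -[dup_mx _ _]/(slot i1).
rewrite -[inl_mx _ _]/(slot i2) -[inr_mx _ _]/(slot i3).
apply: eqmx_trans (sum3_eqmx (fun i => face i s *m slot i)).
apply/eqmxP/andP; split.
  apply/sumsmx_subP => -[i j] _; rewrite (sumsmx_sup i) // !genmxE submxMr //.
  by rewrite (sumsmx_sup j) // genmxE mulmx1.
apply/sumsmx_subP => i _; rewrite genmxE sumsmxMr_gen; apply/sumsmx_subP => j _.
by rewrite (sumsmx_sup (i, j)) // !genmxE (eqmxMr _ (genmxE _)) mulmx1.
Qed.

(** For a septuple the rank [8 * r.+1] is the largest possible ([triple_mx_sub]).  With the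
other three bounds it says that the triple intersection has rank [r.+1]. *)
Definition generic_septuple : set (7.-tuple (rplane R d r)) :=
  septuples R d r
  `&` [set s | (3 * r.+1 <= \rank (face i1 s))%N]
  `&` [set s | (3 * r.+1 <= \rank (face i2 s))%N]
  `&` [set s | (3 * r.+1 <= \rank (face i3 s))%N]
  `&` [set s | (8 * r.+1 <= \rank (faces s))%N].

Lemma zariski_open_generic : zariski_open_in (septuples R d r) generic_septuple.
Proof.
suff -> : generic_septuple = (septuples R d r `&` [set s | (3 * r.+1 <= \rank (face i1 s))%N])
  `&` (septuples R d r `&` [set s | (3 * r.+1 <= \rank (face i2 s))%N])
  `&` (septuples R d r `&` [set s | (3 * r.+1 <= \rank (face i3 s))%N])
  `&` (septuples R d r `&` [set s | (8 * r.+1 <= \rank (faces s))%N]).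
  by do 3!(apply: zariski_open_inI; last exact: zariski_open_in_rank);
     exact: zariski_open_in_rank.
by apply/seteqP; split=> s; rewrite /generic_septuple /setI /=; tauto.
Qed.

Lemma pdimP (V : {vspace 'rV[R]_d.+1}) k : pdim V = k%:Z <-> \dim V = k.+1.
Proof.
rewrite /pdim; split=> [/eqP|->]; last by rewrite intS addrC addKr.
by rewrite subr_eq addrC -intS => /eqP[].
Qed.

Variables (X X1 X2 X3 X12 X13 X23 : rplane R d r).
Let s := [tuple X; X1; X2; X3; X12; X13; X23].
Let Y1 := (B X1 + B X12 + B X13)%MS.
Let Y2 := (B X2 + B X12 + B X23)%MS.
Let Y3 := (B X3 + B X13 + B X23)%MS.

Lemma septuplesP : septuples R d r s <->
  [/\ \rank (B X + B X1 + B X2 + B X3)%MS = (4 * r.+1)%N,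
      (B X12 <= B X + B X1 + B X2)%MS,
      (B X13 <= B X + B X1 + B X3)%MS &
      (B X23 <= B X + B X2 + B X3)%MS].
Proof.
have e4 : (4 * r + 3).+1 = (4 * r.+1)%N by lia.
rewrite -!rowspanS -dim_rowspan !rowspanD !rowspan_basis -e4; split.
  case=> x [x1 [x2 [x3 [x12 [x13 [x23 [es /pdimP]]]]]]].
  by move/(congr1 val): es => /= [-> -> -> -> -> -> ->].
by case=> /pdimP ? ? ? ?; exists X, X1, X2, X3, X12, X13, X23.
Qed.

Lemma face1_eqmx : (face i1 s :=: Y1)%MS.
Proof.
apply: eqmx_trans (sum3_eqmx (fun j => B (tnth s (face_ix _ j)) *m 1%:M)) _.
by rewrite !mulmx1.
Qed.

Lemma face2_eqmx : (face i2 s :=: Y2)%MS.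
Proof.
apply: eqmx_trans (sum3_eqmx (fun j => B (tnth s (face_ix _ j)) *m 1%:M)) _.
by rewrite !mulmx1.
Qed.

Lemma face3_eqmx : (face i3 s :=: Y3)%MS.
Proof.
apply: eqmx_trans (sum3_eqmx (fun j => B (tnth s (face_ix _ j)) *m 1%:M)) _.
by rewrite !mulmx1.
Qed.

Lemma generic_septupleP : generic_septuple s <->
  [/\ septuples R d r s, (3 * r.+1 <= \rank Y1)%N, (3 * r.+1 <= \rank Y2)%N,
      (3 * r.+1 <= \rank Y3)%N & (8 * r.+1 <= \rank (triple_mx Y1 Y2 Y3))%N].
Proof.
rewrite /generic_septuple /setI /= face1_eqmx face2_eqmx face3_eqmx faces_eqmx /triple_mx.
rewrite (adds_eqmx (adds_eqmx (eqmxMr _ face1_eqmx) (eqmxMr _ face2_eqmx))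
                   (eqmxMr _ face3_eqmx)).
by split=> [[[[[]]]]|[]].
Qed.

Lemma generic_unique : generic_septuple s ->
  exists! X123 : rplane R d r,
    [/\ pdim (X1 + X12 + X13 + X123)%VS = (3 * r + 2)%N%:Z,
        pdim (X2 + X12 + X23 + X123)%VS = (3 * r + 2)%N%:Z &
        pdim (X3 + X13 + X23 + X123)%VS = (3 * r + 2)%N%:Z].
Proof.
move/generic_septupleP => [/septuplesP[rW s12 s13 s23] r1 r2 r3 rt].
set W := (B X + B X1 + B X2 + B X3)%MS in rW.
have W0 : (B X <= W)%MS by do 2!apply: submx_trans (addsmxSl _ _); apply: addsmxSl.
have W1 : (B X1 <= W)%MS by do 2!apply: submx_trans (addsmxSl _ _); apply: addsmxSr.
have W2 : (B X2 <= W)%MS by apply: submx_trans (addsmxSl _ _); apply: addsmxSr.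
have W3 : (B X3 <= W)%MS by apply: addsmxSr.
have W12 : (B X12 <= W)%MS by apply: submx_trans s12 _; rewrite !addsmx_sub W0 W1 W2.
have W13 : (B X13 <= W)%MS by apply: submx_trans s13 _; rewrite !addsmx_sub W0 W1 W3.
have W23 : (B X23 <= W)%MS by apply: submx_trans s23 _; rewrite !addsmx_sub W0 W2 W3.
have face_dim (x y z : rplane R d r) (Y := (B x + B y + B z)%MS) :
    (3 * r.+1 <= \rank Y)%N -> \rank Y = (3 * r.+1)%N.
  have := (mxrank_adds_leqif (B x + B y)%MS (B z)).1.
  have := (mxrank_adds_leqif (B x) (B y)).1.
  by rewrite -/Y !rank_basis; lia.
have {}r1 := face_dim _ _ _ r1; have {}r2 := face_dim _ _ _ r2.
have {face_dim}r3 := face_dim _ _ _ r3.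
have rcap : \rank (Y1 :&: Y2 :&: Y3)%MS = r.+1.
  have le_t : (\rank (triple_mx Y1 Y2 Y3) <= \rank W + \rank W)%N.
    by apply: triple_mx_sub; rewrite !addsmx_sub ?W1 ?W2 ?W3 ?W12 ?W13 ?W23.
  (* The rank of the triple space is at least 8n since the septuple is generic,
     and at most 2 dim W = 8n; so the intersection has dimension 9n - 8n. *)
  have := rank_triple_mx Y1 Y2 Y3; rewrite r1 r2 r3; rewrite rW in le_t.
  by lia.
have [X123 eX _] := rplane_of_mx rcap.
have faceP (x y z : rplane R d r) (Y := (B x + B y + B z)%MS) (V : rplane R d r) :
    \rank Y = (3 * r.+1)%N ->
    pdim (x + y + z + V)%VS = (3 * r + 2)%N%:Z <-> (V <= rowspan Y)%VS.
  move=> rY; have -> : (x + y + z)%VS = rowspan Y by rewrite !rowspanD !rowspan_basis.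
  have e3 : (3 * r + 2).+1 = (3 * r.+1)%N by lia.
  rewrite pdimP e3 -rY -dim_rowspan; split=> [eD|/addv_idPl->//].
  apply/addv_idPl/eqP; rewrite eq_sym eqEdim addvSl /=.
  by rewrite eD.
exists X123; split.
  by split; apply/faceP => //; rewrite eX rowspanS ?capmxSr //
     (submx_trans (capmxSl _ _)) ?capmxSl ?capmxSr.
move=> V [/faceP-/(_ r1) V1 /faceP-/(_ r2) V2 /faceP-/(_ r3) V3].
apply: val_inj; apply/eqP; rewrite eq_sym eqEdim -/(pspace V) -/(pspace X123).
rewrite !dim_rplane leqnn andbT eX -(rowspan_basis V) rowspanS !sub_capmx.
by rewrite -!rowspanS rowspan_basis V1 V2 V3.
Qed.
End Septuples.

(** * Density and the theorem *)

Section Density.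
Variables (R : realType) (d r : nat).
Notation B := (@basis_mx R d r).

Lemma zariski_dense_generic : zariski_dense_in (septuples R d r) (@generic_septuple R d r).
Proof.
apply: zariski_dense_of_lines (@zariski_open_generic R d r) _ => p Pp.
have [X [X1 [X2 [X3 [X12 [X13 [X23 [ep _ _ _ _]]]]]]]] := Pp.
move: Pp; rewrite {p}ep => /septuplesP[rW s12 s13 s23].
have rW2 : \rank (B X + B X1 + B X3 + B X2)%MS = (4 * r.+1)%N.
  by rewrite -addsmxA (addsmxC (B X3)) addsmxA.
have rW3 : \rank (B X + B X2 + B X3 + B X1)%MS = (4 * r.+1)%N.
  by rewrite -addsmxA (addsmxC (B X3)) addsmxA -(addsmxA (B X)) (addsmxC (B X2)) addsmxA.
have [Z12 _ e12] := rplane_of_mx (rank_witness rW).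
have [Z13 _ e13] := rplane_of_mx (rank_witness rW2).
have [Z23 _ e23] := rplane_of_mx (rank_witness rW3).
have sum3 (x y z : rplane R d r) : ((B x + B y + B z)%R <= B x + B y + B z)%MS.
  by rewrite !addmx_sub_adds.
exists [tuple X; X1; X2; X3; Z12; Z13; Z23].
  apply/generic_septupleP; split.
  - by apply/septuplesP; rewrite e12 e13 e23.
  - by apply: (rank_witness_face rW); rewrite ?e12 ?e13.
  - apply: (@rank_witness_face _ _ _ _ _ (B X) (B X2) (B X1) (B X3)).
    + by rewrite -(addsmxA (B X)) (addsmxC (B X2)) addsmxA.
    + by rewrite addrAC e12.
    + by rewrite e23.
  - apply: (@rank_witness_face _ _ _ _ _ (B X) (B X3) (B X1) (B X2)).
    + by rewrite -(addsmxA (B X)) (addsmxC (B X3)) addsmxA.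
    + by rewrite addrAC e13.
    + by rewrite addrAC e23.
  have in1 n (a b c : 'M[R]_(n, d.+1)) : (a <= a + b + c)%MS.
    by apply: submx_trans (addsmxSl _ _); apply: addsmxSl.
  have in2 n (a b c : 'M[R]_(n, d.+1)) : (b <= a + b + c)%MS.
    by apply: submx_trans (addsmxSl _ _); apply: addsmxSr.
  have in3 n (a b c : 'M[R]_(n, d.+1)) : (c <= a + b + c)%MS by apply: addsmxSr.
  have -> : (8 * r.+1)%N = (\rank (B X + B X1 + B X2 + B X3)%MS +
                           \rank (B X + B X1 + B X2 + B X3)%MS)%N by rewrite rW; lia.
  apply: sub_triple_mx.
    by apply: witness_span; rewrite -?e12 -?e23 ?in1 ?in2 ?in3.
  rewrite -(addsmxA (_ + _)%MS) (addsmxC (B X2)) addsmxA.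
  apply: witness_span; rewrite ?in1 -?e13 ?in2 ?in3 //.
    by rewrite addrAC -e23 in3.
  by rewrite addrAC -e23 in3.
move=> t s; case/tupleP: s => y; case/tupleP=> y1; case/tupleP=> y2; case/tupleP=> y3.
case/tupleP=> y12; case/tupleP=> y13; case/tupleP=> y23 s; rewrite tuple0 {s} => es.
(* The line is constant in the first four planes, where [p] and its target agree. *)
have const (x y' : rplane R d r) : (B y' :=: (B x + t *: (B x - B x))%R)%MS -> (B y' :=: B x)%MS.
  by rewrite subrr scaler0 addr0.
have e0 := const _ _ (es p0); have e1 := const _ _ (es p1).
have e2 := const _ _ (es p2); have e3 := const _ _ (es p3).
have line (x x' y' : rplane R d r) (W : 'M_d.+1) : (B y' :=: (B x + t *: (B x' - B x))%R)%MS ->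
    (B x <= W)%MS -> (B x' <= W)%MS -> (B y' <= W)%MS.
  by move=> -> sx sx'; rewrite addmx_sub // scalemx_sub // addmx_sub ?eqmx_opp.
have -> : [tuple of y :: [tuple of y1 :: [tuple of y2 :: [tuple of y3 ::
    [tuple of y12 :: [tuple of y13 :: [tuple of y23 :: [tuple]]]]]]]] =
  [tuple y; y1; y2; y3; y12; y13; y23] by apply: val_inj.
apply/septuplesP; split.
- by rewrite (adds_eqmx (adds_eqmx (adds_eqmx e0 e1) e2) e3).
- rewrite (adds_eqmx (adds_eqmx e0 e1) e2).
  by apply: line (es p4) _ _; rewrite // e12.
- rewrite (adds_eqmx (adds_eqmx e0 e1) e3).
  by apply: line (es p5) _ _; rewrite // e13.
- rewrite (adds_eqmx (adds_eqmx e0 e2) e3).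
  by apply: line (es p6) _ _; rewrite // e23.
Qed.
End Density.

Theorem theorem1 (R : realType) (r d : nat) (hd : (4 * r + 3 <= d)%N) :
  exists U : set (7.-tuple (rplane R d r)),
    [/\ zariski_open_in (septuples R d r) U,
        zariski_dense_in (septuples R d r) U &
        forall X X1 X2 X3 X12 X13 X23 : rplane R d r,
          U [tuple X; X1; X2; X3; X12; X13; X23] ->
          exists! X123 : rplane R d r,
            [/\ pdim (X1 + X12 + X13 + X123)%VS = (3 * r + 2)%N%:Z,
                pdim (X2 + X12 + X23 + X123)%VS = (3 * r + 2)%N%:Z &
                pdim (X3 + X13 + X23 + X123)%VS = (3 * r + 2)%N%:Z]].
Proof.
exists (@generic_septuple R d r); split.
- exact: zariski_open_generic.
- exact: zariski_dense_generic.
- by move=> X X1 X2 X3 X12 X13 X23; apply: generic_unique.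
Qed.
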